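(* Let $G=(V,E)$ be a graph with $n$ vertices, and let $$H_I=-\sum_{i\sim j}a_{i,j}Z_iZ_j-\sum_i b_iZ_i$$ be a nonzero Ising Hamiltonian on $G$ with real coefficients $a_{i,j},b_i$ and nonzero coupling matrix $A$, $(A)_{i,j}=a_{i,j}$. Let $\Phi(\rho)$ be the output, on an $n$-qubit input state $\rho$, of a noisy quantum circuit consisting of $D$ layers of unitaries, of which a fraction $f_1$ are layers of one-qubit gates, each followed by one-qubit depolarizing noise of probability $p_1$ on every qubit, and a fraction $f_2=1-f_1$ are layers of two-qubit gates, each followed by one-qubit depolarizing noise of probability $p_2$ on every qubit; in addition the final measurement is affected by depolarizing noise of probability $p_m$ on every qubit (applied at the end of the circuit). Assume $f_1p_1+f_2p_2>0$ and let $\epsilon>0$. If $D\ge D_{\max}$ with $$D_{\max}=\frac{\log\epsilon^{-1}+\log\left(\|H_I\|^{-1}\|A\|n\right)-p_m}{2(f_1p_1+f_2p_2)},$$ then there is a Gibbs state $\tilde\sigma=e^{-\beta H_I}/\mathrm{tr}(e^{-\beta H_I})$, $\beta\ge0$, which satisfies $$\mathrm{tr}\left(H_I(\tilde\sigma-\Phi(\rho))\right)\le\epsilon\|H_I\|$$ and which can be sampled from in polynomial time, in the sense that $\beta$ lies in the rapid-mixing range $\beta\|A\|<1$.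
   Context: $Z_i$ is the Pauli $Z$ matrix acting on qubit $i$ of $(\mathbb C^2)^{\otimes n}$, and $i\sim j$ ranges over the edges $\{i,j\}$ of $G$. $A$ is the symmetric $n\times n$ coupling matrix ($a_{i,j}=0$ for non-edges); $\|\cdot\|$ is the operator norm; $\log$ is the natural logarithm. The one-qubit depolarizing channel with probability $p\in[0,1]$ is $\omega\mapsto(1-p)\omega+p\,\mathrm{tr}(\omega)I/2$; a layer of depolarizing noise is its $n$-fold tensor power. Polynomial-time sampling convention: the paper takes as given (from the literature) the criterion that the Gibbs state $e^{-\beta H_I}/\mathrm{tr}(e^{-\beta H_I})$ can be approximately sampled from in polynomial time as long as $\beta\|A\|<1$; ''can be sampled from in polynomial time'' refers to this criterion. The following known contraction estimate is also part of the setting: for $\sigma=I/2^n$ and $T$ a layer of depolarizing channels with probability $p$, $D(T(\omega)\|\sigma)\le(1-p)^2D(\omega\|\sigma)$ for all states $\omega$, where $D$ is the quantum relative entropy. *)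

(* Defs.v *)
From HB Require Import structures.
From mathcomp Require Import all_boot all_order all_algebra.
From mathcomp Require Import spectral sesquilinear.
From mathcomp Require Import complex mxtens.
From mathcomp Require Import boolp classical_sets reals constructive_ereal sequences exp.

Set Implicit Arguments.
Unset Strict Implicit.
Unset Printing Implicit Defensive.

Import Order.TTheory GRing.Theory Num.Theory.
Local Open Scope ring_scope.
Local Open Scope complex_scope.
Local Open Scope sesquilinear_scope.

Section Matrices.
Context {R : realType}.
Local Notation C := R[i].

Definition vnorm m (v : 'cV[C]_m) : R :=
  Num.sqrt (\sum_i complex.Re `|v i 0| ^+ 2).

Definition opnorm m (M : 'M[C]_m) : R :=
  sup [set vnorm (M *m v) | v in [set v : 'cV[C]_m | vnorm v <= 1]]%classic.

(* Functional calculus f(M) of a Hermitian matrix M, whose eigenvalues are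
   real: M = invmx P *m diag_mx d *m P with P unitary
   (orthomx_spectralP, hermitian_spectral_diag_real). *)
Definition mxfun (f : R -> R) m (M : 'M[C]_m) : 'M[C]_m :=
  invmx (spectralmx M)
    *m diag_mx (map_mx (fun z : C => (f (complex.Re z))%:C) (spectral_diag M))
    *m spectralmx M.

Definition density m (w : 'M[C]_m) : Prop :=
  [/\ w \is hermsymmx,
      forall v : 'cV[C]_m, 0 <= (v ^t* *m w *m v) 0 0
    & \tr w = 1].

(* D(w || s) in nats, +oo unless supp w is contained in supp s; for Hermitian
   matrices this is the inclusion of row spaces.  Since ln 0 = 0, zero
   eigenvalues of w contribute 0 log 0 = 0. *)
Definition relative_entropy m (w s : 'M[C]_m) : \bar R :=
  if (w <= s)%MS
  then (complex.Re (\tr (w *m (mxfun (@ln R) w - mxfun (@ln R) s))))%:E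
  else +oo%E.

Definition gibbs (beta : R) m (H : 'M[C]_m) : 'M[C]_m :=
  let E := mxfun (@expR R) (- beta%:C *: H) in (\tr E)^-1 *: E.

End Matrices.

(* The computational basis of (C^2)^{(x) n} is {ffun 'I_n -> 'I_2}; its 2 ^ n
   elements are numbered by enum_val. *)
Notation qdim n := #|{ffun 'I_n -> 'I_2}|.

Definition bit n (x : 'I_(qdim n)) (k : 'I_n) : 'I_2 := enum_val x k.

Section Qubits.
Context {R : realType}.
Local Notation C := R[i].

Definition tensor_op n (M : 'I_n -> 'M[C]_2) : 'M[C]_(qdim n) :=
  \matrix_(x, y) \prod_k M k (bit x k) (bit y k).

Definition pauliZ : 'M[C]_2 := \matrix_(a, b) ((a == b)%:R * (-1) ^+ a).

Definition Zop n (i : 'I_n) : 'M[C]_(qdim n) :=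
  tensor_op (fun k => if k == i then pauliZ else 1%:M).

Definition two_qubit_op n (i j : 'I_n) (U : 'M[C]_(2 * 2)) : 'M[C]_(qdim n) :=
  \matrix_(x, y)
    (U (mxtens_index (bit x i, bit x j)) (mxtens_index (bit y i, bit y j))
     * \prod_(k | (k != i) && (k != j)) (bit x k == bit y k)%:R).

Definition ising n (e : rel 'I_n) (A : 'M[R]_n) (b : 'I_n -> R)
    : 'M[C]_(qdim n) :=
  - (\sum_(i < n) \sum_(j < n | (i < j)%N && e i j)
       (A i j)%:C *: (Zop i *m Zop j))
  - \sum_(i < n) (b i)%:C *: Zop i.

Definition coupling_norm n (A : 'M[R]_n) : R := opnorm (map_mx (real_complex R) A).

Definition max_mixed n : 'M[C]_(qdim n) := ((2 ^+ n)^-1)%:M.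

Definition depol1 (p : R) (w : 'M[C]_2) : 'M[C]_2 :=
  (1 - p)%:C *: w + (p%:C * \tr w) *: (2^-1)%:M.

(* The n-fold tensor power of a linear map N on 2 x 2 matrices, given by its
   values (x)_k N(E_(x_k, y_k)) on the matrix units E_(x, y). *)
Definition tensor_power (N : 'M[C]_2 -> 'M[C]_2) n (w : 'M[C]_(qdim n))
    : 'M[C]_(qdim n) :=
  \sum_x \sum_y
    w x y *: tensor_op (fun k => N (delta_mx (bit x k) (bit y k))).

Definition depol_layer n (p : R) : 'M[C]_(qdim n) -> 'M[C]_(qdim n) :=
  @tensor_power (depol1 p) n.

(* A two-qubit gate ((i, j), U) acts on the ordered pair of qubits (i, j). *)
Inductive layer n :=
  | OneQubitLayer of 'I_n -> 'M[C]_2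
  | TwoQubitLayer of seq ('I_n * 'I_n * 'M[C]_(2 * 2)).

Definition is_one_qubit_layer n (l : layer n) : bool :=
  if l is OneQubitLayer _ then true else false.

(* Gates are unitary, and the two-qubit gates of a layer act on pairwise
   disjoint pairs of distinct qubits. *)
Definition valid_layer n (l : layer n) : bool :=
  match l with
  | OneQubitLayer U => [forall k, U k \is unitarymx]
  | TwoQubitLayer gs =>
      uniq (flatten [seq [:: g.1.1; g.1.2] | g <- gs])
      && all (fun g => g.2 \is unitarymx) gs
  end.

Definition layer_op n (l : layer n) : 'M[C]_(qdim n) :=
  match l with
  | OneQubitLayer U => tensor_op U
  | TwoQubitLayer gs =>
      \big[mulmx/1%:M]_(g <- gs) two_qubit_op g.1.1 g.1.2 g.2
  end.

Definition noisy_layer n (p1 p2 : R) (l : layer n) (w : 'M[C]_(qdim n))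
    : 'M[C]_(qdim n) :=
  depol_layer (if is_one_qubit_layer l then p1 else p2)
    (layer_op l *m w *m (layer_op l) ^t*).

(* The first element of c acts first. *)
Definition noisy_circuit n (p1 p2 pm : R) (c : seq (layer n))
    (rho : 'M[C]_(qdim n)) : 'M[C]_(qdim n) :=
  depol_layer pm (foldl (fun w l => noisy_layer p1 p2 l w) rho c).

End Qubits.

Arguments layer : clear implicits.
Arguments max_mixed : clear implicits.

(* Main.v *)
(* For a state w, non-negativity of the relative entropy to the Gibbs state s at
   inverse temperature beta gives
   beta * tr (H (s - w)) <= S(s) - S(w) <= D(w || I/2^n).
   This last quantity is at most n ln 2 on the input, is preserved by unitary
   layers, and shrinks by (1 - p)^2 <= exp(-2 p) under a depolarizing layer, so at
   depth at least D_max it is at most ln 2 * eps * ||H|| / ||A|| at the output.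
   Hence beta = ln 2 / ||A|| works, and beta ||A|| = ln 2 < 1. *)
Require Import Defs.
From HB Require Import structures.
From mathcomp Require Import all_boot all_order all_algebra.
From mathcomp Require Import spectral sesquilinear.
From mathcomp Require Import complex mxtens.
From mathcomp Require Import boolp classical_sets reals constructive_ereal sequences exp.
From mathcomp Require Import ring lra.
Import Order.TTheory GRing.Theory Num.Theory.
Local Open Scope ring_scope.
Local Open Scope complex_scope.

Set Implicit Arguments.
Unset Strict Implicit.
Unset Printing Implicit Defensive.

(** * Adjoints, unitary conjugation and traces *)

Section Adjoint.
Local Open Scope sesquilinear_scope.
Context {C : numClosedFieldType}.

Lemma hermsymmxE m (M : 'M[C]_m) : (M \is hermsymmx) = (M == M ^t*).
Proof. by rewrite is_hermitianmxE expr0 scale1r. Qed.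

Lemma adjmxM m n p (M : 'M[C]_(m, n)) (N : 'M[C]_(n, p)) :
  (M *m N) ^t* = N ^t* *m M ^t*.
Proof. by rewrite trmx_mul map_mxM. Qed.

Lemma unitary_mulV m (P : 'M[C]_m) : P \is unitarymx -> P *m P ^t* = 1%:M.
Proof. by move/unitarymxP. Qed.

Lemma unitary_mulVl m (P : 'M[C]_m) : P \is unitarymx -> P ^t* *m P = 1%:M.
Proof. by move/unitarymxP/mulmx1C. Qed.

(** Multiplying by [Q] on the left and [P ^t*] on the right trades an equality of diagonalizations
    for a relation linear in the transition matrix [Q *m P ^t*], which can be compared entry by
    entry. *)
Lemma unitary_similar m (P Q D E : 'M[C]_m) :
    P \is unitarymx -> Q \is unitarymx ->
  P ^t* *m D *m P = Q ^t* *m E *m Q <-> Q *m P ^t* *m D = E *m (Q *m P ^t*).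
Proof.
move=> uP uQ; split=> [eqDE|eqT].
  transitivity (Q *m (P ^t* *m D *m P) *m P ^t*).
    by rewrite !mulmxA mulmxtVK.
  by rewrite eqDE !mulmxA unitary_mulV// mul1mx.
transitivity (Q ^t* *m (Q *m P ^t* *m D) *m P).
  by rewrite !mulmxA unitary_mulVl// mul1mx.
by rewrite eqT !mulmxA mulmxKtV.
Qed.

Lemma unitary_trace m (P Q D E : 'M[C]_m) :
  \tr (P ^t* *m D *m P *m (Q ^t* *m E *m Q)) =
  \tr (P *m Q ^t* *m E *m (P *m Q ^t*) ^t* *m D).
Proof.
rewrite -!mulmxA mxtrace_mulC -!mulmxA mxtrace_mulC adjmxM trmxCK.
by rewrite !mulmxA.
Qed.

Lemma unitaryJ m (P D U : 'M[C]_m) :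
  (P *m U ^t*) ^t* *m D *m (P *m U ^t*) = U *m (P ^t* *m D *m P) *m U ^t*.
Proof. by rewrite adjmxM trmxCK !mulmxA. Qed.

Lemma unitary_scalar m (P : 'M[C]_m) a : P \is unitarymx ->
  P ^t* *m a%:M *m P = a%:M.
Proof.
by move=> uP; rewrite mul_mx_scalar -scalemxAl unitary_mulVl// scalemx1.
Qed.

Lemma unitary_transition m (P Q : 'M[C]_m) :
  P \is unitarymx -> Q \is unitarymx -> P *m Q ^t* \is unitarymx.
Proof. by move=> uP uQ; rewrite mul_unitarymx// trmxC_unitary. Qed.

Lemma unitary_row_norm m (T : 'M[C]_m) i :
  T \is unitarymx -> \sum_j `|T i j| ^+ 2 = 1.
Proof.
move=> /unitary_mulV/matrixP/(_ i i); rewrite !mxE eqxx mulr1n => <-.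
by apply: eq_bigr => j _; rewrite !mxE normCK.
Qed.

Lemma unitary_col_norm m (T : 'M[C]_m) j :
  T \is unitarymx -> \sum_i `|T i j| ^+ 2 = 1.
Proof.
move=> /unitary_mulVl/matrixP/(_ j j); rewrite !mxE eqxx mulr1n => <-.
by apply: eq_bigr => i _; rewrite !mxE mulrC normCK.
Qed.

Lemma trace_mul_diag m (T : 'M[C]_m) a b :
  \tr (T *m diag_mx b *m T ^t* *m diag_mx a) =
  \sum_i \sum_j `|T i j| ^+ 2 * (a 0 i * b 0 j).
Proof.
apply: eq_bigr => i _; rewrite mul_mx_diag mxE mul_mx_diag mxE mulr_suml.
apply: eq_bigr => j _; rewrite !mxE normCK.
by rewrite [T i j * _ * _]mulrAC -[LHS]mulrA [b 0 j * _]mulrC.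
Qed.

(** The adjoint of row [i] of [P] is the [i]-th vector of the diagonalizing basis, so positivity of
    a quadratic form passes to the eigenvalues. *)
Lemma unitary_form m (P D : 'M[C]_m) i : P \is unitarymx ->
  (((row i P) ^t*) ^t* *m (P ^t* *m D *m P) *m (row i P) ^t*) 0 0 = D i i.
Proof.
move=> uP; rewrite trmxCK rowE adjmxM !mulmxA !mulmxtVK//.
by rewrite trmx_delta map_delta_mx -colE -rowE !mxE.
Qed.

Lemma unitary_conjM m (P D E : 'M[C]_m) : P \is unitarymx ->
  P ^t* *m D *m P *m (P ^t* *m E *m P) = P ^t* *m (D *m E) *m P.
Proof. by move=> uP; rewrite !mulmxA mulmxtVK. Qed.

Lemma unitary_conj_trace m (P D : 'M[C]_m) : P \is unitarymx ->
  \tr (P ^t* *m D *m P) = \tr D.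
Proof. by move=> uP; rewrite mxtrace_mulC mulmxA unitary_mulV// mul1mx. Qed.

End Adjoint.

(** * Unitary diagonalization with real spectrum *)

Section Unitary.
Local Open Scope sesquilinear_scope.
Context {R : realType}.
Local Notation C := R[i].

(** The basis [P] is any unitary and the spectrum is stored over [R]: one matrix may be presented in
    several bases, and entropies become real sums. *)
Definition udiag m (P : 'M[C]_m) (d : 'rV[R]_m) : 'M[C]_m :=
  P ^t* *m diag_mx (map_mx (real_complex R) d) *m P.

Lemma udiag_herm m (P : 'M[C]_m) d : udiag P d \is hermsymmx.
Proof.
rewrite hermsymmxE /udiag !adjmxM trmxCK mulmxA tr_diag_mx map_diag_mx.
rewrite -map_mx_comp (_ : map_mx (_ \o _) d = map_mx (real_complex R) d)//.
by apply/rowP => i; rewrite !mxE; exact: conjc_real.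
Qed.

Lemma hermitian_udiag m (M : 'M[C]_m) : M \is hermsymmx ->
  {P : 'M[C]_m & {d | P \is unitarymx & M = udiag P d}}.
Proof.
move=> hM; exists (spectralmx M).
exists (map_mx (@complex.Re R) (spectral_diag M)).
  exact: spectral_unitarymx.
rewrite {1}(orthomx_spectralP (hermitian_normalmx hM)) /udiag.
rewrite (invmx_unitary (spectral_unitarymx M)) -map_mx_comp.
rewrite (_ : map_mx (_ \o _) _ = spectral_diag M)//.
apply/rowP => i; rewrite mxE /= RRe_real//.
exact: (mxOverP (hermitian_spectral_diag_real hM)).
Qed.

Lemma udiag_unitaryJ m (P U : 'M[C]_m) d :
  udiag (P *m U ^t*) d = U *m udiag P d *m U ^t*.
Proof. exact: unitaryJ. Qed.

(* If two unitary diagonalizations agree, the change of basis intertwines the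
   spectra entrywise, hence also their images under f. *)
Lemma mxfun_udiag (f : R -> R) m (P : 'M[C]_m) d : P \is unitarymx ->
  mxfun f (udiag P d) = udiag P (map_mx f d).
Proof.
move=> uP; set M := udiag P d.
have [hM uQ] := (udiag_herm P d : M \is _, spectral_unitarymx M).
rewrite /mxfun (invmx_unitary uQ).
have := orthomx_spectralP (hermitian_normalmx hM).
rewrite (invmx_unitary uQ) {1}/M /udiag.
move: (spectralmx M) (spectral_diag M) uQ => Q s uQ.
move/(unitary_similar (diag_mx _) (diag_mx s) uP uQ) => E.
apply/esym/(unitary_similar (diag_mx _) (diag_mx _) uP uQ).
move: (Q *m P ^t*) E => T E.
apply/matrixP => i j; have := congr1 (fun X : 'M_m => X i j) E.
rewrite !mul_mx_diag !mul_diag_mx !mxE.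
have [->|T0] := eqVneq (T i j) 0; first by rewrite !mulr0 !mul0r.
by rewrite mulrC => /(mulIf T0) <-; rewrite mulrC.
Qed.

Lemma udiag_const m (P : 'M[C]_m) (a : R) : P \is unitarymx ->
  udiag P (const_mx a) = (a%:C)%:M.
Proof.
move=> uP; rewrite /udiag map_const_mx diag_const_mx.
exact: unitary_scalar.
Qed.

(* t i j is the transition probability |<p_i, q_j>|^2 between the two bases. *)
Lemma trace_udiagM m (P Q : 'M[C]_m) : P \is unitarymx -> Q \is unitarymx ->
  exists t : 'I_m -> 'I_m -> R,
    [/\ forall i j, 0 <= t i j,
        forall j, \sum_i t i j = 1, forall i, \sum_j t i j = 1
      & forall a b, \tr (udiag P a *m udiag Q b) =
          (\sum_i \sum_j t i j * (a 0 i * b 0 j))%:C].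
Proof.
move=> uP uQ; have := unitary_transition uP uQ.
have trE := @unitary_trace _ m P Q; move: (P *m Q ^t*) trE => T trE uT.
pose t i j := complex.Re (`|T i j| ^+ 2).
have tE i j : (t i j)%:C = `|T i j| ^+ 2.
  by rewrite /t RRe_real// ger0_real// exprn_ge0.
exists t; split.
- by move=> i j; rewrite -ler0c tE exprn_ge0.
- move=> j; apply/complexI; rewrite rmorph_sum rmorph1 /= -(unitary_col_norm j uT).
  by apply: eq_bigr => i _; rewrite tE.
- move=> i; apply/complexI; rewrite rmorph_sum rmorph1 /= -(unitary_row_norm i uT).
  by apply: eq_bigr => j _; rewrite tE.
- move=> a b; rewrite trE trace_mul_diag rmorph_sum; apply: eq_bigr => i _.
  rewrite rmorph_sum; apply: eq_bigr => j _.
  by rewrite !rmorphM /= tE !mxE.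
Qed.
End Unitary.

(** * Klein's inequality, Gibbs states and relative entropy *)

Section Entropy.
Local Open Scope sesquilinear_scope.
Context {R : realType}.
Local Notation C := R[i].

(** This is [ln y <= y - 1] at [y = g / x], multiplied by [x]; at [x = 0] it reduces to
    [- g <= 0]. *)
Lemma xlnx_ge (x g : R) : 0 <= x -> 0 < g -> x * ln g + x - g <= x * ln x.
Proof.
rewrite le_eqVlt => /predU1P[<- g0|x0 g0]; first by rewrite !mul0r !add0r oppr_le0 ltW.
have gx : -1 < g / x - 1 by rewrite ltrBrDl subrr divr_gt0.
have := ler_wpM2l (ltW x0) (le_ln1Dx gx).
rewrite addrCA subrr addr0 ln_div ?posrE//.
rewrite !mulrBr mulr1 mulrCA divff ?gt_eqF// mulr1; lra.
Qed.

(** As [t] is doubly stochastic, every single sum becomes a double sum weighted by [t], and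
    [xlnx_ge] applies term by term. With [t] the transition probabilities between two eigenbases,
    this is non-negativity of the quantum relative entropy. *)
Lemma klein (I J : finType) (t : I -> J -> R) (x : I -> R) (g : J -> R) :
    (forall i j, 0 <= t i j) ->
    (forall j, \sum_i t i j = 1) -> (forall i, \sum_j t i j = 1) ->
    (forall i, 0 <= x i) -> (forall j, 0 < g j) ->
    \sum_i x i = 1 -> \sum_j g j = 1 ->
  \sum_i \sum_j t i j * (x i * ln (g j)) <= \sum_i x i * ln (x i).
Proof.
move=> t0 tc tr x0 g0 x1 g1.
have xE (h : I -> R) : \sum_i h i = \sum_i \sum_j t i j * h i.
  by apply: eq_bigr => i _; rewrite -mulr_suml tr mul1r.
have gE : \sum_j g j = \sum_i \sum_j t i j * g j.
  by rewrite exchange_big; apply: eq_bigr => j _; rewrite -mulr_suml tc mul1r.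
(* The two added sums are both 1 and cancel; they supply the linear terms of [xlnx_ge]. *)
suff: \sum_i \sum_j t i j * (x i * ln (g j)) + \sum_i x i - \sum_j g j <=
    \sum_i x i * ln (x i) by rewrite x1 g1 addrK.
rewrite (xE x) (xE (fun i => x i * ln (x i))) gE -big_split -sumrB.
apply: ler_sum => i _; rewrite -big_split -sumrB; apply: ler_sum => j _ /=.
by rewrite -mulrDr -mulrBr ler_wpM2l// xlnx_ge.
Qed.

Lemma udiagB m (P : 'M[C]_m) a b : udiag P (a - b) = udiag P a - udiag P b.
Proof. by rewrite /udiag map_mxB raddfB /= mulmxBr mulmxBl. Qed.

Lemma udiagZ m (P : 'M[C]_m) (k : R) a : udiag P (k *: a) = k%:C *: udiag P a.
Proof. by rewrite /udiag map_mxZ linearZ /= -scalemxAr -scalemxAl. Qed.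

Lemma udiagM m (P : 'M[C]_m) a b : P \is unitarymx ->
  udiag P a *m udiag P b = udiag P (\row_i (a 0 i * b 0 i)).
Proof.
move=> uP; rewrite /udiag (unitary_conjM _ _ uP) mulmx_diag.
set x := \row_i _; set y := map_mx _ (\row_i _); suff -> : x = y by [].
by apply/rowP => i; rewrite !mxE rmorphM.
Qed.

Lemma trace_udiag m (P : 'M[C]_m) d : P \is unitarymx ->
  \tr (udiag P d) = (\sum_i d 0 i)%:C.
Proof.
move=> uP; rewrite /udiag unitary_conj_trace// mxtrace_diag rmorph_sum.
by apply: eq_bigr => i _; rewrite mxE.
Qed.

Lemma density_udiag m (w : 'M[C]_m) : density w ->
  exists P d, [/\ P \is unitarymx, w = udiag P d,
    forall i, 0 <= d 0 i & \sum_i d 0 i = 1].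
Proof.
case=> hw w0 w1; have [P [d uP wE]] := hermitian_udiag hw.
exists P, d; split=> //.
  move=> i; have := w0 ((row i P) ^t*).
  by rewrite wE /udiag unitary_form// !mxE eqxx mulr1n ler0c.
by apply/complexI; rewrite -(trace_udiag _ uP) -wE w1 rmorph1.
Qed.

(** The maximally mixed state is invertible, which settles the support condition, and scalar, hence
    diagonal in the basis [P] with logarithm [- n ln 2]. *)
Lemma relative_entropy_max_mixed n (P : 'M[C]_(qdim n)) (d : 'rV[R]_(qdim n)) :
    P \is unitarymx ->
    \sum_i d 0 i = 1 ->
  relative_entropy (udiag P d) (max_mixed R n) =
  (\sum_i d 0 i * ln (d 0 i) + n%:R * ln 2)%:E.
Proof.
move=> uP d1; have p2 : 0 < (2 ^+ n : R) by rewrite exprn_gt0.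
have sE : max_mixed R n = udiag P (const_mx (2 ^+ n)^-1).
  by rewrite udiag_const// /max_mixed fmorphV rmorphXn rmorph_nat.
rewrite /relative_entropy submx_full ?row_full_unit; last first.
  rewrite unitmxE det_scalar unitrX// unitfE invr_eq0 expf_eq0.
  by rewrite pnatr_eq0 andbF.
congr EFin; rewrite sE !mxfun_udiag// -udiagB udiagM// trace_udiag//=.
have -> : n%:R * ln 2 = \sum_i d 0 i * (n%:R * ln 2).
  by rewrite -mulr_suml d1 mul1r.
rewrite -big_split /=; apply: eq_bigr => i _.
rewrite !mxE lnV ?posrE// lnXn// mulrBr mulrN opprK.
by rewrite -[ln 2 *+ n]mulr_natl.
Qed.

Lemma gibbs_udiag beta m (Q : 'M[C]_m) h : Q \is unitarymx ->
  gibbs beta (udiag Q h) =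
  udiag Q (\row_j (expR (- beta * h 0 j) / \sum_k expR (- beta * h 0 k))).
Proof.
move=> uQ; rewrite /gibbs -rmorphN -udiagZ mxfun_udiag// trace_udiag//.
rewrite -fmorphV -udiagZ; congr udiag; apply/rowP => j.
rewrite !mxE mulrC; congr (_ / _).
by apply: eq_bigr => k _; rewrite !mxE.
Qed.

(* The variational principle: log Z = max over states of S(w) - beta tr(w H),
   attained at the Gibbs state, whose entropy is at most log m. *)
Lemma gibbs_gap beta m (P Q : 'M[C]_m) (d h : 'rV[R]_m) :
    P \is unitarymx -> Q \is unitarymx ->
    (forall i, 0 <= d 0 i) -> \sum_i d 0 i = 1 ->
  exists2 x : R, \tr (udiag Q h *m (gibbs beta (udiag Q h) - udiag P d)) = x%:C
    & beta * x <= \sum_i d 0 i * ln (d 0 i) + ln m%:R.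
Proof.
move=> uP uQ d0 d1.
have m0 : (0 < m)%N.
  case: m P Q d h uP uQ d0 d1 => // P Q d h _ _ _ /esym/eqP.
  by rewrite big_ord0 oner_eq0.
pose Z := \sum_k expR (- beta * h 0 k); pose g := \row_j (expR (- beta * h 0 j) / Z).
have Z0 : 0 < Z.
  rewrite /Z (bigD1 (Ordinal m0)) //= ltr_wpDr ?expR_gt0//.
  by apply: sumr_ge0 => k _; exact: expR_ge0.
have g0 j : 0 < g 0 j by rewrite mxE divr_gt0 ?expR_gt0.
have g1 : \sum_j g 0 j = 1.
  rewrite (eq_bigr (fun j => expR (- beta * h 0 j) / Z)) => [|j _]; last by rewrite mxE.
  by rewrite -mulr_suml divff ?gt_eqF.
have lng j : ln (g 0 j) = - beta * h 0 j - ln Z.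
  by rewrite mxE ln_div ?posrE ?expR_gt0// expRK.
have [t [t0 tc tr trE]] := trace_udiagM uP uQ.
exists (\sum_j h 0 j * g 0 j - \sum_i \sum_j t i j * (d 0 i * h 0 j)).
  rewrite gibbs_udiag// -/g mulmxBr raddfB /= udiagM// trace_udiag//.
  rewrite [\tr (_ *m udiag P d)]mxtrace_mulC trE rmorphB /=; congr (_%:C - _).
  by apply: eq_bigr => j _; rewrite !mxE.
have := klein t0 tc tr d0 g0 d1 g1.
have -> : \sum_i \sum_j t i j * (d 0 i * ln (g 0 j)) =
    - beta * (\sum_i \sum_j t i j * (d 0 i * h 0 j)) - ln Z.
  have -> : ln Z = \sum_i \sum_j t i j * (d 0 i * ln Z).
    under eq_bigr do rewrite -mulr_suml tr mul1r.
    by rewrite -mulr_suml d1 mul1r.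
  rewrite mulr_sumr -sumrB; apply: eq_bigr => i _.
  rewrite mulr_sumr -sumrB; apply: eq_bigr => j _; rewrite lng; ring.
have gE : \sum_j g 0 j * ln (g 0 j) = - beta * (\sum_j h 0 j * g 0 j) - ln Z.
  rewrite -[ln Z]mul1r -g1 mulr_suml mulr_sumr -sumrB; apply: eq_bigr => j _.
  rewrite lng; ring.
(* The entropy of [g] is at most [ln m]: [xlnx_ge] compares [g] with the uniform distribution. *)
have : - ln m%:R <= \sum_j g 0 j * ln (g 0 j).
  have mi : 0 < (m%:R : R)^-1 by rewrite invr_gt0 ltr0n.
  have -> : - ln m%:R = \sum_j (g 0 j * ln (m%:R)^-1 + g 0 j - (m%:R)^-1) :> R.
    rewrite sumrB big_split /= -mulr_suml g1 mul1r sumr_const card_ord.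
    by rewrite -(mulr_natr m%:R^-1) mulVf ?pnatr_eq0 -?lt0n// addrK lnV ?posrE ?ltr0n.
  by apply: ler_sum => j _; rewrite xlnx_ge// ltW.
(* Adding Klein's inequality to the entropy bound cancels [ln Z]. *)
rewrite gE; lra.
Qed.

(** In dimension [2 ^ n] the bound of [gibbs_gap] is exactly the relative entropy to the maximally
    mixed state. *)
Lemma gibbs_gap_relative_entropy beta n (H w : 'M[C]_(qdim n)) (D : R) :
    0 < beta -> H \is hermsymmx -> density w ->
    (relative_entropy w (max_mixed R n) <= D%:E)%E ->
  \tr (H *m (gibbs beta H - w)) <= (D / beta)%:C.
Proof.
move=> beta0 /hermitian_udiag[Q [h uQ ->]] /density_udiag[P [d [uP -> d0 d1]]].
rewrite relative_entropy_max_mixed// lee_fin => leD.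
have [x -> le_x] := gibbs_gap beta h uP uQ d0 d1.
rewrite lecR ler_pdivlMr// mulrC (le_trans le_x)// (le_trans _ leD)//.
by rewrite lerD2l card_ffun !card_ord natrX lnXn// mulr_natl.
Qed.

(** Eigenvalues of a state lie in [[0, 1]], so each [d ln d] is non-positive. The real witness [D]
    lets later estimates leave the extended reals. *)
Lemma relative_entropy_max_mixed_fin n (w : 'M[C]_(qdim n)) : density w ->
  exists D : R, relative_entropy w (max_mixed R n) = D%:E /\ D <= n%:R * ln 2.
Proof.
move=> /density_udiag[P [d [uP -> d0 d1]]].
eexists; split; first exact: relative_entropy_max_mixed.
rewrite gerDr; apply: sumr_le0 => i _; rewrite mulr_ge0_le0// ln_le0//.
rewrite -d1 (bigD1 i)//= lerDl; exact: sumr_ge0.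
Qed.

End Entropy.

(** * Positivity of the operator norm *)

Section OperatorNorm.
Local Open Scope sesquilinear_scope.
Context {R : realType}.
Local Notation C := R[i].

Lemma vnorm_delta m (j : 'I_m) : vnorm (delta_mx j 0 : 'cV[C]_m) = 1.
Proof.
have dE i : complex.Re `|(delta_mx j 0 : 'cV[C]_m) i 0| ^+ 2 = (i == j)%:R.
  rewrite mxE eqxx andbT; case: eqP => _.
    by rewrite mulr1n normr1 expr1n.
  by rewrite mulr0n normr0 expr0n.
rewrite /vnorm (eq_bigr _ (fun i _ => dE i)) (bigD1 j)//= eqxx big1 ?addr0 ?sqrtr1//.
by move=> i /negPf ->.
Qed.

Lemma Re_norm_ge0 (z : C) : 0 <= complex.Re `|z|.
Proof. by rewrite -ler0c RRe_real ?normr_ge0// normr_real. Qed.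

Lemma le_vnorm m (v : 'cV[C]_m) i : complex.Re `|v i 0| <= vnorm v.
Proof.
rewrite -[leLHS]ger0_norm ?Re_norm_ge0// -sqrtr_sqr ler_wsqrtr//.
by rewrite (bigD1 i)// lerDl sumr_ge0// => k _; exact: sqr_ge0.
Qed.

Lemma vnorm_le m (v : 'cV[C]_m) (B : R) :
  (forall i, complex.Re `|v i 0| <= B) -> vnorm v <= Num.sqrt (m%:R * B ^+ 2).
Proof.
move=> vB; rewrite ler_wsqrtr// mulr_natl -[m in leRHS]card_ord -sumr_const.
apply: ler_sum => i _; rewrite ler_sqr ?nnegrE ?Re_norm_ge0//.
by rewrite (le_trans _ (vB i)) ?Re_norm_ge0.
Qed.

(** On the unit ball every coordinate has modulus at most 1, so each coordinate of the image is
    bounded by the sum [B] of all entry moduli. Boundedness is what makes [sup] dominate the values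
    it ranges over. *)
Lemma opnorm_has_ubound m (M : 'M[C]_m) :
  has_ubound [set vnorm (M *m v) | v in [set v : 'cV[C]_m | vnorm v <= 1]]%classic.
Proof.
pose B := \sum_i \sum_j complex.Re `|M i j|.
exists (Num.sqrt (m%:R * B ^+ 2)) => _ [v /= v1 <-]; apply: vnorm_le => i.
apply: (@le_trans _ _ (\sum_j complex.Re `|M i j|)); last first.
  rewrite /B [leRHS](bigD1 i)// lerDl sumr_ge0// => k _.
  by rewrite sumr_ge0// => j _; exact: Re_norm_ge0.
rewrite -lecR rmorph_sum. rewrite RRe_real ?normr_real// mxE.
apply: le_trans (ler_norm_sum _ _ _) _; apply: ler_sum => j _.
rewrite normrM -[leRHS]/((complex.Re `|M i j|)%:C) RRe_real ?normr_real// ler_piMr//.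
rewrite -[leLHS]RRe_real ?normr_real// -(rmorph1 (real_complex R)) lecR.
exact: le_trans (le_vnorm _ _) v1.
Qed.

(** A nonzero entry [M i j] is seen by testing on the [j]-th basis vector. *)
Lemma opnorm_gt0 m (M : 'M[C]_m) : M != 0 -> 0 < opnorm M.
Proof.
move=> M0; have [i [j Mij]] : exists i j, M i j != 0.
  apply: contrapT => M00; move/eqP: M0; apply; apply/matrixP => i j.
  by rewrite mxE; apply/eqP/negPn/negP => Mij; apply: M00; exists i, j.
have : vnorm (M *m delta_mx j 0) <= opnorm M.
  apply: ub_le_sup; first exact: opnorm_has_ubound.
  by exists (delta_mx j 0) => //=; rewrite vnorm_delta.
apply: lt_le_trans; apply: lt_le_trans (le_vnorm _ i).
by rewrite -colE mxE -ltcR RRe_real ?normr_real// normr_gt0.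
Qed.

End OperatorNorm.

(** * Tensor products of one-qubit matrices *)

Section Tensor.
Local Open Scope sesquilinear_scope.
Context {R : realType} {n : nat}.
Local Notation C := R[i].
Implicit Types (M N : 'I_n -> 'M[C]_2) (x y : 'I_(qdim n)).

(** Passing from basis numbers to bit strings makes the distributivity of products over sums
    applicable. *)
Lemma sum_bits (F : {ffun 'I_n -> 'I_2} -> C) :
  \sum_(x < qdim n) F (enum_val x) = \sum_f F f.
Proof. by rewrite [RHS](reindex _ (onW_bij _ (@enum_val_bij _))). Qed.

Lemma prod_bool (I : finType) (P : pred I) (b : I -> bool) :
  \prod_(k | P k) (b k)%:R = [forall k, P k ==> b k]%:R :> C.
Proof.
case: (boolP [forall k, P k ==> b k]) => [/forallP/(_ _)/implyP Pb|].
  by rewrite big1// => k /Pb ->.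
rewrite negb_forall => /existsP[k]; rewrite negb_imply => /andP[Pk /negPf bk].
by rewrite (bigD1 k)//= bk mul0r.
Qed.

Lemma forall_bit_eq x y : [forall k, bit x k == bit y k] = (x == y).
Proof.
apply/forallP/eqP => [xy|-> k//].
by apply: enum_val_inj; apply/ffunP => k; apply/eqP/xy.
Qed.

Lemma tensor_opM M N :
  tensor_op M *m tensor_op N = tensor_op (fun k => M k *m N k).
Proof.
apply/matrixP => x z; rewrite !mxE.
under [RHS]eq_bigr do rewrite mxE.
rewrite bigA_distr_bigA /= -sum_bits; apply: eq_bigr => y _.
by rewrite !mxE -big_split.
Qed.

Lemma tensor_op1 : tensor_op (fun k : 'I_n => 1%:M : 'M[C]_2) = 1%:M.
Proof.
apply/matrixP => x y; rewrite !mxE.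
by under eq_bigr do rewrite mxE; rewrite prod_bool /= forall_bit_eq.
Qed.

Lemma tensor_op_adj M : (tensor_op M) ^t* = tensor_op (fun k => (M k) ^t*).
Proof.
by apply/matrixP => x y; rewrite !mxE rmorph_prod; apply: eq_bigr => k _; rewrite !mxE.
Qed.

Lemma tensor_op_delta x y :
  tensor_op (fun k => delta_mx (bit x k) (bit y k) : 'M[C]_2) = delta_mx x y.
Proof.
apply/matrixP => u v; rewrite !mxE -!forall_bit_eq.
under eq_bigr do rewrite mxE; rewrite prod_bool /=; congr (_%:R); congr nat_of_bool.
apply/forallP/andP => [uv|[/forallP ux /forallP vy] k]; last by rewrite ux vy.
by split; apply/forallP => k; have /andP[] := uv k.
Qed.

Lemma tensor_op_sum (I : finType) (M : I -> 'I_n -> 'M[C]_2) :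
  tensor_op (fun k => \sum_a M a k) =
  \sum_(f : {ffun 'I_n -> I}) tensor_op (fun k => M (f k) k).
Proof.
apply/matrixP => x y; rewrite !mxE summxE.
under eq_bigr do rewrite summxE.
by rewrite bigA_distr_bigA; apply: eq_bigr => f _; rewrite mxE.
Qed.

Lemma eq_tensor_op M N : M =1 N -> tensor_op M = tensor_op N.
Proof. by move=> /funext ->. Qed.

Lemma trace_tensor_op M : \tr (tensor_op M) = \prod_k \tr (M k).
Proof.
rewrite bigA_distr_bigA /= -sum_bits; apply: eq_bigr => x _.
by rewrite mxE.
Qed.

Lemma tensor_op_unitary M :
  (forall k, M k \is unitarymx) -> tensor_op M \is unitarymx.
Proof.
move=> uM; apply/unitarymxP; rewrite tensor_op_adj tensor_opM -tensor_op1.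
by apply: eq_tensor_op => k; rewrite unitary_mulV.
Qed.

End Tensor.

(** * Two-qubit gates and unitarity of layers *)

Section TwoQubit.
Local Open Scope sesquilinear_scope.
Context {R : realType} {n : nat}.
Local Notation C := R[i].
Context (i j : 'I_n).
Implicit Types U V : 'M[C]_(2 * 2).

Lemma two_qubit_op1 : two_qubit_op i j (1%:M : 'M[C]_(2 * 2)) = 1%:M.
Proof.
apply/matrixP => x y; rewrite !mxE prod_bool -natrM mulnb.
congr (_%:R); congr nat_of_bool; rewrite -forall_bit_eq.
rewrite (can_eq (@mxtens_indexK 2 2)) xpair_eqE.
apply/andP/forallP => [[/andP[xi xj] /forallP xk] k|xy].
  have := xk k; have [->|_] := eqVneq k i; first by [].
  by have [->|_] := eqVneq k j.
by split; [rewrite !xy|apply/forallP => k; rewrite xy implybT].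
Qed.

Lemma two_qubit_op_adj U : (two_qubit_op i j U) ^t* = two_qubit_op i j (U ^t*).
Proof.
apply/matrixP => x y; rewrite !mxE rmorphM rmorph_prod; congr (_ * _).
by apply: eq_bigr => k _; rewrite [LHS]rmorph_nat eq_sym.
Qed.

Lemma two_qubit_opM U V : i != j ->
  two_qubit_op i j U *m two_qubit_op i j V = two_qubit_op i j (U *m V).
Proof.
move=> ij; apply/matrixP => x z; rewrite !mxE.
pose P (f : {ffun 'I_n -> 'I_2}) := [forall k, (k != i) && (k != j) ==> (bit x k == f k)].
pose Q := [forall k, (k != i) && (k != j) ==> (bit x k == bit z k)].
pose F f := U (mxtens_index (bit x i, bit x j)) (mxtens_index (f i, f j)) *
            V (mxtens_index (f i, f j)) (mxtens_index (bit z i, bit z j)) * Q%:R.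
(* Only intermediate basis states agreeing with [x] off the pair contribute to the matrix
   product. *)
transitivity (\sum_(f | P f) F f).
  rewrite [RHS]big_mkcond -sum_bits; apply: eq_bigr => y _; rewrite !mxE !prod_bool.
  set bxy := [forall k, _ ==> (bit x k == bit y k)].
  have -> : bxy = P (enum_val y) by [].
  rewrite /F mulrACA; case: (boolP (P _)) => [/forallP/(_ _)/implyP xy|_]; last first.
    by rewrite mul0r mulr0.
  rewrite mul1r /Q; congr (_ * (nat_of_bool _)%:R).
  apply: eq_forallb => k; case: (boolP (_ && _)) => //= kij.
  by rewrite (eqP (xy k kij)).
(* [h q] is [x] with the bits at [i] and [j] replaced by those of [q]; it parametrizes the surviving
   terms by the index set of [U]. *)
pose h (q : 'I_(2 * 2)) := [ffun k => if k == i then (mxtens_unindex q).1 else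
  if k == j then (mxtens_unindex q).2 else bit x k].
rewrite (reindex_onto h (fun f => mxtens_index (f i, f j))) /=; last first.
  move=> f /forallP/(_ _)/implyP xf; apply/ffunP => k; rewrite ffunE mxtens_indexK /=.
  case: eqVneq => [->//|ki]; case: eqVneq => [->//|kj].
  by apply/eqP/xf; rewrite ki kj.
(* Here [i != j] matters: otherwise the first bit would overwrite the second. *)
have hij q : mxtens_index (h q i, h q j) = q.
  by rewrite !ffunE !eqxx eq_sym (negPf ij) -surjective_pairing mxtens_unindexK.
rewrite prod_bool -/Q mulr_suml; apply: eq_big => [q|q _]; last by rewrite /F hij.
rewrite hij eqxx andbT; apply/forallP => k; apply/implyP => /andP[/negPf ki /negPf kj].
by rewrite ffunE ki kj.
Qed.

Lemma two_qubit_op_unitary U : i != j -> U \is unitarymx ->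
  two_qubit_op i j U \is unitarymx.
Proof.
move=> ij uU; apply/unitarymxP.
by rewrite two_qubit_op_adj two_qubit_opM// unitary_mulV// two_qubit_op1.
Qed.

End TwoQubit.

(** Uniqueness in the flattened list of qubits gives [i != j] for every gate, so each factor is
    unitary. *)
Lemma layer_op_unitary (R : realType) n (l : layer R n) :
  valid_layer l -> layer_op l \is unitarymx.
Proof.
case: l => [U|gs] /=; first by move/forallP; exact: tensor_op_unitary.
elim: gs => [_|[[i j] U] gs IH].
  by rewrite big_nil; apply/unitarymxP; rewrite trmx1 map_mx1 mulmx1.
rewrite /= big_cons !inE negb_or => /andP[/andP[/andP[ij _] /andP[_ ugs]] /andP[uU ags]].
by rewrite mul_unitarymx ?two_qubit_op_unitary// IH// ugs.
Qed.

(** * Kraus form of depolarizing noise and preservation of states *)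

Section Channels.
Local Open Scope sesquilinear_scope.
Context {R : realType}.
Local Notation C := R[i].

(** The quadratic form of each summand at [v] is that of [w] at [(K a) ^t* *m v]. Trace preservation
    is asked for [w] alone, since for noise layers it is proved directly on matrix units. *)
Lemma density_conj_sum (I : finType) m (K : I -> 'M[C]_m) (w : 'M[C]_m) :
    density w -> \tr (\sum_a K a *m w *m (K a) ^t*) = \tr w ->
  density (\sum_a K a *m w *m (K a) ^t*).
Proof.
move=> [hw w0 w1] trK; split; last by rewrite trK.
  rewrite hermsymmxE raddf_sum raddf_sum; apply/eqP/eq_bigr => a _.
  rewrite -[RHS]/((_ *m _ *m _) ^t*) !adjmxM trmxCK mulmxA.
  by move: hw; rewrite hermsymmxE => /eqP <-.
move=> v; rewrite mulmx_sumr mulmx_suml summxE sumr_ge0// => a _.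
by have := w0 ((K a) ^t* *m v); rewrite adjmxM trmxCK !mulmxA.
Qed.

Lemma density_unitary m (U w : 'M[C]_m) : U \is unitarymx ->
  density w -> density (U *m w *m U ^t*).
Proof.
move=> uU dw; have := @density_conj_sum 'I_1 m (fun=> U) w dw.
by rewrite big_ord1; apply; rewrite mxtrace_mulC mulmxA unitary_mulVl// mul1mx.
Qed.

Lemma trace_depol1 (p : R) (w : 'M[C]_2) : \tr (depol1 p w) = \tr w.
Proof.
rewrite /depol1 mxtraceD !mxtraceZ mxtrace_scalar -[2^-1 *+ 2]mulr_natr.
rewrite mulVf ?pnatr_eq0// mulr1 -mulrDl -rmorphD subrK rmorph1 mul1r.
by [].
Qed.

Lemma trace_depol_layer n (p : R) (w : 'M[C]_(qdim n)) :
  \tr (depol_layer p w) = \tr w.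
Proof.
rewrite [in RHS](matrix_sum_delta w) /depol_layer /tensor_power !raddf_sum.
apply: eq_bigr => x _; rewrite !raddf_sum; apply: eq_bigr => y _.
rewrite /= !mxtraceZ -tensor_op_delta !trace_tensor_op.
by under eq_bigr do rewrite trace_depol1.
Qed.

(* Kraus operators of depol1, from tr(w) I = sum_(i, j) E_ij w E_ij^*. *)
Definition depol_kraus (p : R) (a : 'I_1 + 'I_2 * 'I_2) : 'M[C]_2 :=
  match a with
  | inl _ => (Num.sqrt (1 - p))%:C%:M
  | inr (i, j) => (Num.sqrt (p / 2))%:C *: delta_mx i j
  end.

Lemma delta_conj m (w : 'M[C]_m) (i j : 'I_m) :
  delta_mx i j *m w *m (delta_mx i j) ^t* = w j j *: delta_mx i i.
Proof.
rewrite trmx_delta map_delta_mx -(mul_delta_mx (0 : 'I_1) i j).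
rewrite -(mul_delta_mx (0 : 'I_1) j i) !mulmxA -!(mulmxA (delta_mx i 0)).
rewrite [X in _ *m (X *m _)]mx11_scalar mul_scalar_mx -rowE -colE !mxE.
by rewrite -scalemxAr mul_delta_mx.
Qed.

Lemma adj_realZ m k (a : R) (M : 'M[C]_(m, k)) : (a%:C *: M) ^t* = a%:C *: M ^t*.
Proof. by apply/matrixP => i j; rewrite !mxE rmorphM; congr (_ * _); exact: conjc_real. Qed.

Lemma depol1_kraus (p : R) (w : 'M[C]_2) : 0 <= p <= 1 ->
  depol1 p w = \sum_a depol_kraus p a *m w *m (depol_kraus p a) ^t*.
Proof.
move=> /andP[p0 p1].
rewrite big_sumType /= big_ord1 /depol1; congr (_ + _).
  rewrite -scalemx1 adj_realZ trmx1 map_mx1 -!scalemxAl -scalemxAr mulmx1 mul1mx.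
  by rewrite scalerA -rmorphM -expr2 sqr_sqrtr ?subr_ge0.
transitivity (\sum_i \sum_j (p%:C / 2 * w j j) *: delta_mx i i : 'M[C]_2).
  under [RHS]eq_bigr do rewrite -scaler_suml -mulr_sumr.
  by rewrite -scaler_sumr -mx1_sum_delta scalemx1 scale_scalar_mx mulrAC.
rewrite pair_bigA; apply: eq_bigr => -[i j] _ /=.
rewrite adj_realZ -!scalemxAl -scalemxAr scalerA delta_conj scalerA.
congr (_ * _ *: _); rewrite -rmorphM -expr2 sqr_sqrtr ?divr_ge0//.
by rewrite rmorphM fmorphV rmorph_nat.
Qed.

(** By linearity it suffices to treat matrix units, which are tensor products; expanding the product
    over qubits chooses one Kraus operator [f k] for each qubit. *)
Lemma depol_layer_kraus n (p : R) (w : 'M[C]_(qdim n)) : 0 <= p <= 1 ->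
  depol_layer p w = \sum_(f : {ffun 'I_n -> 'I_1 + 'I_2 * 'I_2})
    tensor_op (fun k => depol_kraus p (f k)) *m w *m
    (tensor_op (fun k => depol_kraus p (f k))) ^t*.
Proof.
move=> p01.
transitivity (\sum_(f : {ffun 'I_n -> 'I_1 + 'I_2 * 'I_2}) \sum_x \sum_y
    w x y *: (tensor_op (fun k => depol_kraus p (f k)) *m delta_mx x y *m
    (tensor_op (fun k => depol_kraus p (f k))) ^t*)); last first.
  apply: eq_bigr => f _; rewrite [in RHS](matrix_sum_delta w).
  rewrite mulmx_sumr mulmx_suml; apply: eq_bigr => x _.
  rewrite mulmx_sumr mulmx_suml; apply: eq_bigr => y _.
  by rewrite -scalemxAr -scalemxAl.
rewrite exchange_big; apply: eq_bigr => x _.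
rewrite exchange_big; apply: eq_bigr => y _.
rewrite -scaler_sumr; congr (_ *: _).
under eq_tensor_op do rewrite depol1_kraus//.
rewrite tensor_op_sum; apply: eq_bigr => f _.
by rewrite -tensor_op_delta tensor_op_adj !tensor_opM.
Qed.

Lemma density_depol_layer n (p : R) (w : 'M[C]_(qdim n)) : 0 <= p <= 1 ->
  density w -> density (depol_layer p w).
Proof.
move=> p01 dw; rewrite depol_layer_kraus//; apply: density_conj_sum => //.
by rewrite -depol_layer_kraus// trace_depol_layer.
Qed.

(** Conjugation changes the eigenbasis to [P *m U ^t*] and keeps the eigenvalues, on which alone the
    formula depends. *)
Lemma relative_entropy_unitary n (U w : 'M[C]_(qdim n)) : U \is unitarymx ->
  density w ->
  relative_entropy (U *m w *m U ^t*) (max_mixed R n) =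
  relative_entropy w (max_mixed R n).
Proof.
move=> uU /density_udiag[P [d [uP -> _ d1]]]; rewrite -udiag_unitaryJ.
have uPU := unitary_transition uP uU.
by rewrite (relative_entropy_max_mixed uPU d1) (relative_entropy_max_mixed uP d1).
Qed.

End Channels.

(** * Entropy decay along the noisy circuit *)

Section Circuit.
Local Open Scope sesquilinear_scope.
Context {R : realType} {n : nat}.
Local Notation C := R[i].
Implicit Types (w : 'M[C]_(qdim n)).

(** The [Zop i] are self-adjoint and commute, so their products are self-adjoint, and the
    coefficients are real. *)
Lemma ising_herm (e : rel 'I_n) (A : 'M[R]_n) (b : 'I_n -> R) :
  ising e A b \is hermsymmx.
Proof.
have Zh i : (Zop i : 'M[C]_(qdim n)) ^t* = Zop i.
  rewrite /Zop tensor_op_adj; apply: eq_tensor_op => k; case: eqP => _.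
    apply/matrixP => x y; rewrite !mxE rmorphM rmorph_nat rmorph_sign eq_sym.
    by case: eqP => [->//|_]; rewrite !mul0r.
  by rewrite trmx1 map_mx1.
have ZZ i j : (Zop i : 'M[C]_(qdim n)) *m Zop j = Zop j *m Zop i.
  rewrite !tensor_opM; apply: eq_tensor_op => k.
  by case: (k == i); case: (k == j); rewrite ?mulmx1 ?mul1mx.
have hB (M N : 'M[C]_(qdim n)) : (M - N) ^t* = M ^t* - N ^t*.
  by rewrite raddfB /= map_mxB.
rewrite hermsymmxE /ising hB; apply/eqP; congr (_ - _).
  rewrite raddfN /= map_mxN; congr (- _); rewrite !raddf_sum; apply: eq_bigr => i _.
  rewrite !raddf_sum; apply: eq_bigr => j _.
  by rewrite -[RHS]/((_ *: _) ^t*) adj_realZ adjmxM !Zh ZZ.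
rewrite !raddf_sum; apply: eq_bigr => i _.
by rewrite -[RHS]/((_ *: _) ^t*) adj_realZ Zh.
Qed.

Context (contraction : forall (p : R) w, 0 <= p <= 1 -> density w ->
  (relative_entropy (depol_layer p w) (max_mixed R n)
     <= ((1 - p) ^+ 2)%:E * relative_entropy w (max_mixed R n))%E).

(** Squaring [1 - p <= expR (- p)] turns the contraction factor into an exponential, so that
    exponents add up over layers. *)
Lemma depol_layer_entropy p w (D : R) : 0 <= p <= 1 -> 0 <= D -> density w ->
  (relative_entropy w (max_mixed R n) <= D%:E)%E ->
  (relative_entropy (depol_layer p w) (max_mixed R n) <= (expR (- 2 * p) * D)%:E)%E.
Proof.
move=> p01 D0 dw; have [D' [wD' _]] := relative_entropy_max_mixed_fin dw.
have := contraction p01 dw; rewrite wD' lee_fin => le1 le2.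
apply: le_trans le1 _; rewrite -EFinM lee_fin.
apply: (@le_trans _ _ ((1 - p) ^+ 2 * D)); first by rewrite ler_wpM2l// sqr_ge0.
have /andP[_ p1] := p01.
rewrite ler_wpM2r// mulNr -mulrN expRM_natl lerXn2r ?nnegrE ?subr_ge0 ?expR_ge0//.
exact: expR_ge1Dx.
Qed.

(** Induction on the circuit with the state and its bound [D] both general: the first layer replaces
    [D] by [expR (- 2 * p) * D]. *)
Lemma noisy_layers_entropy p1 p2 (c : seq (layer R n)) w (D : R) :
    0 <= p1 <= 1 -> 0 <= p2 <= 1 -> all (@valid_layer R n) c ->
    0 <= D -> density w -> (relative_entropy w (max_mixed R n) <= D%:E)%E ->
  let w' := foldl (fun w l => noisy_layer p1 p2 l w) w c in
  let q := (count (@is_one_qubit_layer R n) c)%:R in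
  density w' /\ (relative_entropy w' (max_mixed R n) <=
    (expR (- 2 * (q * p1 + ((size c)%:R - q) * p2)) * D)%:E)%E.
Proof.
move=> p1_01 p2_01; elim: c w D => [|l c IH] w D /=.
  by rewrite !(mul0r, subrr, addr0, mulr0) expR0 mul1r.
move=> /andP[vl vc] D0 dw wD; have uU := layer_op_unitary vl.
set p := if is_one_qubit_layer l then p1 else p2.
have p01 : 0 <= p <= 1 by rewrite /p; case: ifP.
have dw1 := density_unitary uU dw.
have [] := IH (noisy_layer p1 p2 l w) (expR (- 2 * p) * D) vc.
- by rewrite mulr_ge0 ?expR_ge0.
- exact: (density_depol_layer p01 dw1).
- apply: (depol_layer_entropy p01 D0 dw1).
  by rewrite (relative_entropy_unitary uU dw).
move=> d1 le1; split=> //; apply: le_trans le1 _.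
rewrite lee_fin mulrA -expRD ler_wpM2r// ler_expR natrD -addn1 natrD /p.
by case: (is_one_qubit_layer l) => /=; lra.
Qed.

End Circuit.

(** * Depth bound and choice of temperature *)

Lemma ln2_lt1 (R : realType) : ln 2 < 1 :> R.
Proof. by rewrite -ltr_expR lnK ?posrE// expR_gt1Dx// oner_neq0. Qed.

Theorem proposition2 (R : realType) (n : nat)
    (e : rel 'I_n) (e_sym : symmetric e) (e_irr : irreflexive e)
    (A : 'M[R]_n) (b : 'I_n -> R)
    (A_sym : A^T = A) (A_edges : forall i j, ~~ e i j -> A i j = 0)
    (A_neq0 : A != 0) (H_neq0 : ising e A b != 0)
    (p1 p2 pm f1 f2 eps : R)
    (p1_01 : 0 <= p1 <= 1) (p2_01 : 0 <= p2 <= 1) (pm_01 : 0 <= pm <= 1)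
    (contraction : forall (p : R) (w : 'M[R[i]]_(qdim n)),
       0 <= p <= 1 -> density w ->
       (relative_entropy (depol_layer p w) (max_mixed R n)
          <= ((1 - p) ^+ 2)%:E * relative_entropy w (max_mixed R n))%E)
    (c : seq (layer R n)) (c_valid : all (@valid_layer R n) c)
    (f1_01 : 0 <= f1 <= 1)
    (f1_frac : (count (@is_one_qubit_layer R n) c)%:R = f1 * (size c)%:R)
    (f2_def : f2 = 1 - f1)
    (rate_gt0 : 0 < f1 * p1 + f2 * p2) (eps_gt0 : 0 < eps)
    (depth_ge :
       (ln eps^-1 + ln ((opnorm (ising e A b))^-1 * coupling_norm A * n%:R) - pm)
         / (2 * (f1 * p1 + f2 * p2)) <= (size c)%:R)
    (rho : 'M[R[i]]_(qdim n)) (rho_state : density rho) :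
  exists beta : R,
    [/\ 0 <= beta,
        \tr (ising e A b *m
             (gibbs beta (ising e A b) - noisy_circuit p1 p2 pm c rho))
          <= (eps * opnorm (ising e A b))%:C
      & beta * coupling_norm A < 1].
Proof.
have cA0 : 0 < coupling_norm A.
  by apply: opnorm_gt0; rewrite map_mx_eq0.
have cH0 : 0 < opnorm (ising e A b) by exact: opnorm_gt0.
(* For [n = 0] the matrix [A] would be empty, hence zero. Positivity of [n] makes the argument of
   the logarithm positive. *)
have n0 : 0 < n%:R :> R.
  rewrite ltr0n lt0n; apply: contraNneq A_neq0 => n0.
  by apply/eqP/matrixP => i; have := ltn_ord i; rewrite {2}n0.
have ln20 : 0 < ln 2 :> R by rewrite ln_gt0// ltr1n.
set a := coupling_norm A in cA0 depth_ge *.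
set h := opnorm _ in cH0 depth_ge *.
exists (ln 2 / a); split; first by rewrite divr_ge0 ?ltW.
  have D0 : 0 <= n%:R * ln 2 :> R by rewrite mulr_ge0 ?ltW.
  have [D [rhoE leD]] := relative_entropy_max_mixed_fin rho_state.
  have rhoD : (relative_entropy rho (max_mixed R n) <= (n%:R * ln 2)%:E)%E.
    by rewrite rhoE lee_fin.
  have [dw wD] := noisy_layers_entropy contraction p1_01 p2_01 c_valid D0 rho_state rhoD.
  have K0 x : 0 <= expR x * (n%:R * ln 2) :> R by rewrite mulr_ge0 ?expR_ge0.
  have outD := depol_layer_entropy contraction pm_01 (K0 _) dw wD.
  have dout := density_depol_layer pm_01 dw.
  have beta0 : 0 < ln 2 / a by rewrite divr_gt0.
  have := gibbs_gap_relative_entropy beta0 (ising_herm e A b) dout outD.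
  move/le_trans; apply; rewrite lecR f1_frac.
  set r := f1 * p1 + f2 * p2 in rate_gt0 depth_ge.
  have -> : f1 * (size c)%:R * p1 + ((size c)%:R - f1 * (size c)%:R) * p2 = r * (size c)%:R.
    by rewrite /r f2_def; ring.
  have X0 : 0 < eps^-1 * (h^-1 * a * n%:R) by rewrite !mulr_gt0 ?invr_gt0.
  (* The depth hypothesis, multiplied by [2 * r], bounds the layer exponent up to one [pm]; the
     final noise contributes [2 * pm], and [0 <= pm] absorbs the surplus. *)
  have leE : expR (- 2 * pm) * expR (- 2 * (r * (size c)%:R)) <=
      (eps^-1 * (h^-1 * a * n%:R))^-1.
    rewrite -[leRHS]lnK ?posrE ?invr_gt0// -expRD ler_expR lnV ?posrE//.
    rewrite lnM ?posrE ?invr_gt0 ?mulr_gt0 ?invr_gt0//.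
    move: depth_ge; rewrite ler_pdivrMr ?mulr_gt0//.
    have /andP[pm0 _] := pm_01; lra.
  move: leE; set E1 := expR _; set E2 := expR _ => leE.
  (* The [ln 2] of the initial entropy bound cancels the one in [beta]. *)
  have -> : E1 * (E2 * (n%:R * ln 2)) / (ln 2 / a) = E1 * E2 * (n%:R * a).
    by field; rewrite !gt_eqF.
  apply: le_trans (ler_wpM2r _ leE) _; first by rewrite mulr_ge0 ?ltW.
  (* What remains is the equality [eps * h / (a * n) * (n * a) = eps * h]. *)
  rewrite le_eqVlt; apply/orP; left; apply/eqP; field.
  by rewrite !gt_eqF.
by rewrite divfK ?gt_eqF// ln2_lt1.
Qed.
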